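(* Let $\mathfrak{S}=\{f_S : S\subset\mathbb{N}^*\text{ is a Sidon set}\}\subset\mathcal{O}(\mathbb{D})$, and for $n\in\mathbb{N}^*$ let $\mathfrak{S}_n=\{f_S : S\subset\{1,\dots,n\}\text{ is a Sidon set}\}$. Let $\phi:\mathfrak{S}\to\mathbb{R}^+$ be continuous for the topology induced by $\mathcal{O}(\mathbb{D})$. Then $$\max_{f\in\mathfrak{S}}\phi(f)=\lim_{n\to\infty}\max_{f\in\mathfrak{S}_n}\phi(f).$$
   Context: $\mathbb{D}$ is the open unit disk in $\mathbb{C}$ and $\mathcal{O}(\mathbb{D})$ is the space of holomorphic functions on $\mathbb{D}$ with the topology of uniform convergence on compact subsets. For $B\subset\mathbb{N}$, $f_B(z)=\sum_{n\ge0}\mathbbm{1}_B(n)z^n$. A Sidon set is a set $S$ of positive integers such that all the sums $s+s'$ with $s,s'\in S$, $s\le s'$, are distinct. *)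

(* Defs.v *)
From HB Require Import structures.
From mathcomp Require Import all_boot all_order all_algebra.
From mathcomp Require Import all_classical all_reals all_analysis.
From mathcomp Require Import complex ring lra.

Set Implicit Arguments.
Unset Strict Implicit.
Unset Printing Implicit Defensive.

Import Order.TTheory GRing.Theory Num.Theory.
Import numFieldNormedType.Exports.

Local Open Scope classical_set_scope.
Local Open Scope ring_scope.

HB.instance Definition _ (R : realType) := NormedModule.copy R[i] R[i]^o.

Definition unit_disk (R : realType) : set R[i] := [set z | `|z| < 1].
Arguments unit_disk R : clear implicits.

(* [derivable] is taken along 1 over the scalar field R[i], so it is complex
   differentiability. The extension by 0 outside the disk only serves to apply
   [derivable]: the disk is open, so the values outside are irrelevant. *)
Definition holomorphic (R : realType) (f : unit_disk R -> R[i]) : Prop :=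
  forall z : R[i], unit_disk R z -> derivable ('valL_ 0 f) z 1.

(* O(D). Coerced to a type, this set carries the topology induced by
   {family compact, _ -> _}, i.e. uniform convergence on compact subsets. *)
Definition hol_disk (R : realType) :
  set {family compact, unit_disk R -> R[i]} := [set f | holomorphic f].
Arguments hol_disk R : clear implicits.

Definition gen_series (R : realType) (B : set nat) (z : R[i]) : R[i] :=
  limn (series (fun n => \1_B n * z ^+ n)).

Section power_series.
Variable R : realType.
Local Notation C := R[i].
Local Open Scope complex_scope.

Lemma cvg_series_complex (u : nat -> C) (M : C) :
  (forall n, series (fun k => `|u k|) n <= M) -> cvgn (series u).
Proof.
move=> uM.
have M0 : 0 <= M by have := uM 0%N; rewrite seriesEord /= big_ord0.
pose rM : R := complex.Re M.
have ME : M = rM%:C by rewrite /rM; case: M {uM rM} M0 => a b; rewrite lecE/= => /andP[/eqP -> _].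
pose nu k : R := Normc.normc (u k).
have nuM n : series nu n <= rM.
  have := uM n; rewrite ME !seriesEord /= => h.
  rewrite -lecR; apply: le_trans h.
  by rewrite rmorph_sum/= lexx.
have cv (p : C -> R) : (forall z, `|p z| <= Normc.normc z) -> cvgn (series (p \o u)).
  move=> pn; apply: normed_cvg => /=.
  apply: nondecreasing_is_cvgn.
    by apply: (@nondecreasing_series R (fun k => `|(p \o u) k|) xpredT 0).
  exists rM => _ [n _ <-]; apply: le_trans (nuM n).
  by apply: ler_sum => i _; exact: pn.
have Ren (z : C) : `|complex.Re z| <= Normc.normc z.
  case: z => a b /=; rewrite -sqrtr_sqr ler_wsqrtr// lerDl sqr_ge0//.
have Imn (z : C) : `|complex.Im z| <= Normc.normc z.
  case: z => a b /=; rewrite -sqrtr_sqr ler_wsqrtr// lerDr sqr_ge0//.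
have [a aP] := (cvg_ex _).1 (cv _ Ren).
have [b bP] := (cvg_ex _).1 (cv _ Imn).
apply/cvg_ex; exists (a +i* b).
apply/cvgrPdist_lt => e e0.
pose r : R := complex.Re e.
have er : e = r%:C by rewrite /r; case: e {r} e0 => x y; rewrite ltcE/= => /andP[/eqP -> _].
have r0 : 0 < r by move: e0; rewrite er ltcR.
have r2 : 0 < r / 2 by rewrite divr_gt0.
move/cvgrPdist_lt: aP => /(_ _ r2) aP.
move/cvgrPdist_lt: bP => /(_ _ r2) bP.
near=> n.
have an : `|a - series (complex.Re (R:=R) \o u) n| < r / 2 by near: n.
have bn : `|b - series (complex.Im (R:=R) \o u) n| < r / 2 by near: n.
have -> : a +i* b - series u n =
  (a - series (complex.Re (R:=R) \o u) n)%:C + 'i * (b - series (complex.Im (R:=R) \o u) n)%:C.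
  have -> : series u n = (series (complex.Re (R:=R) \o u) n) +i* (series (complex.Im (R:=R) \o u) n).
    rewrite !seriesEord /=; elim/big_rec3: _ => //= i x y z _ ->.
    by case: (u i).
  by simpc.
have -> : e = (r / 2)%:C + (r / 2)%:C by rewrite -rmorphD/= -splitr.
apply: le_lt_trans (ler_normD _ _) _.
apply: ltrD.
  by rewrite normc_def/= expr0n addr0 sqrtr_sqr ltcR.
rewrite normrM [X in X * _]normc_def/= expr0n expr1n add0r sqrtr1 mul1r.
by rewrite normc_def/= expr0n addr0 sqrtr_sqr ltcR.
Unshelve. all: by end_near. Qed.


Lemma mid1_lt (K : numFieldType) (x : K) : x < 1 ->
  x < (1 + x) / 2 /\ (1 + x) / 2 < 1.
Proof.
move=> x1; split.
  by rewrite ltr_pdivlMr ?ltr0Sn// mulr_natr mulr2n ltrD2r.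
by rewrite ltr_pdivrMr ?ltr0Sn// mul1r (natrD _ 1 1) ltrD2l.
Qed.

Lemma sum_rec_le (K : numFieldType) (r e0 B : K) (e b : nat -> K) :
  0 <= r -> r < 1 -> 0 <= e0 -> e 0%N <= e0 ->
  (forall n, e n.+1 <= r * e n + b n) ->
  (forall n, \sum_(k < n) b k <= B) ->
  forall n, \sum_(k < n) e k <= (e0 + B) / (1 - r).
Proof.
move=> r0 r1 e00 ee0 eS bB.
have B0 : 0 <= B by have := bB 0%N; rewrite big_ord0.
elim=> [|n IHn].
  by rewrite big_ord0 divr_ge0 ?subr_ge0 ?(ltW r1) ?addr_ge0.
rewrite big_ord_recl /=.
have -> : (e0 + B) / (1 - r) = e0 + (r * ((e0 + B) / (1 - r)) + B).
  have : 1 - r != 0 by rewrite subr_eq0 eq_sym lt_eqF.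
  by move=> ?; field.
apply: lerD => //.
have : \sum_(i < n) e i.+1 <= \sum_(i < n) (r * e i + b i) by apply: ler_sum => i _; exact: eS.
move=> /le_trans; apply.
rewrite big_split /= -mulr_sumr; apply: lerD; last exact: bB.
exact: ler_wpM2l.
Qed.

Lemma geom_sum_le (r : C) n : 0 <= r -> r < 1 ->
  \sum_(k < n) r ^+ k <= (1 - r)^-1.
Proof.
move=> r0 r1.
have := @sum_rec_le C r 1 0 (fun k => r ^+ k) (fun=> 0) r0 r1 ler01.
rewrite addr0 mul1r; apply.
- by rewrite expr0.
- by move=> k; rewrite exprS addr0.
- by move=> k; rewrite big1.
Qed.

Lemma dgeom_sum_le (r : C) n : 0 <= r -> r < 1 ->
  \sum_(k < n) k%:R * r ^+ k.-1 <= (1 - r)^-1 / (1 - r).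
Proof.
move=> r0 r1.
have := @sum_rec_le C r 0 (1 - r)^-1 (fun k => k%:R * r ^+ k.-1) (fun k => r ^+ k) r0 r1 (lexx _).
rewrite add0r; apply.
- by rewrite mul0r.
- move=> [|k]/=; first by rewrite mul0r mulr0 add0r mul1r.
  by rewrite mulrCA -exprS -[k.+2%:R]natr1 mulrDl mul1r.
- by move=> k; exact: geom_sum_le.
Qed.

Lemma taylor_sum_le (r z h : C) n : r < 1 -> `|z| <= r -> `|z + h| <= r ->
  \sum_(k < n) `|(z + h) ^+ k - z ^+ k - h * (k%:R * z ^+ k.-1)| <=
  `|h| ^+ 2 * ((1 - r)^-1 / (1 - r)) / (1 - r).
Proof.
move=> r1 zr zhr.
have r0 : 0 <= r by apply: le_trans zr.
have := @sum_rec_le C r 0 (`|h| ^+ 2 * ((1 - r)^-1 / (1 - r)))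
  (fun k => `|(z + h) ^+ k - z ^+ k - h * (k%:R * z ^+ k.-1)|)
  (fun k => `|h| ^+ 2 * (k%:R * r ^+ k.-1)) r0 r1 (lexx _).
rewrite add0r; apply.
- by rewrite !expr0 subrr mul0r mulr0 subr0 normr0.
- move=> k.
  have -> : (z + h) ^+ k.+1 - z ^+ k.+1 - h * (k.+1%:R * z ^+ k.+1.-1) =
     (z + h) * ((z + h) ^+ k - z ^+ k - h * (k%:R * z ^+ k.-1)) +
     h ^+ 2 * (k%:R * z ^+ k.-1).
    case: k => [|k] /=; first by rewrite !expr0 !expr1; ring.
    by rewrite -[k.+2%:R]natr1 [z ^+ k.+2]exprS [(z + h) ^+ k.+2]exprS [z ^+ k.+1]exprS; ring.
  apply: le_trans (ler_normD _ _) _; apply: lerD.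
    by rewrite normrM ler_wpM2r.
  rewrite !normrM !normrX normr_nat ler_wpM2l ?exprn_ge0// ler_wpM2l ?ler0n//.
  by rewrite lerXn2r ?nnegrE.
- by move=> k; rewrite -mulr_sumr ler_wpM2l ?exprn_ge0// dgeom_sum_le.
Qed.

Lemma le_norm_lim (u : nat -> C) (l B : C) : u @ \oo --> l ->
  (forall n, `|u n| <= B) -> `|l| <= B.
Proof.
move=> ul uB.
have B0 : 0 <= B by apply: le_trans (uB 0%N).
rewrite real_leNgt ?ger0_real//; apply/negP => Bl.
move/cvgrPdist_lt: ul => /(_ (`|l| - B)); rewrite subr_gt0 => /(_ Bl) [n _ /(_ n (leqnn n))] /=.
rewrite ltrBrDr => /lt_le_trans lt1.
have : `|l| <= `|l - u n| + B.
  rewrite -{1}(subrK (u n) l); apply: le_trans (ler_normD _ _) _.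
  by rewrite lerD2l.
by rewrite addrC in lt1 *; move=> /lt1; rewrite ltxx.
Qed.

Variable a : nat -> C.
Hypothesis a1 : forall n, `|a n| <= 1.

Lemma cvg_bounded_pseries (z : C) : `|z| < 1 ->
  cvgn (series (fun n => a n * z ^+ n)).
Proof.
move=> z1; apply: (@cvg_series_complex _ (1 - `|z|)^-1) => n.
rewrite /series /= big_mkord; apply: le_trans (geom_sum_le n (normr_ge0 z) z1).
apply: ler_sum => i _; rewrite normrM normrX.
by apply: ler_piMl; [exact: exprn_ge0|exact: a1].
Qed.

Lemma derivable_bounded_pseries (z : C) : `|z| < 1 ->
  derivable (fun w : C => limn (series (fun n => a n * w ^+ n)) : C) z 1.
Proof.
move=> z1; set F := fun w => _.
pose da n := a n * (n%:R * z ^+ n.-1).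
have cda : cvgn (series da).
  apply: (@cvg_series_complex _ ((1 - `|z|)^-1 / (1 - `|z|))) => n.
  rewrite /series /= big_mkord; apply: le_trans (dgeom_sum_le n (normr_ge0 z) z1).
  apply: ler_sum => i _; rewrite /da 2!normrM normrX normr_nat.
  by apply: ler_piMl; [rewrite mulr_ge0 ?ler0n ?exprn_ge0|exact: a1].
pose r := (1 + `|z|) / 2.
have [zr r1] : `|z| < r /\ r < 1 by exact: mid1_lt.
pose M := ((1 - r)^-1 / (1 - r)) / (1 - r).
have M0 : 0 < M by rewrite !mulr_gt0 ?invr_gt0 ?subr_gt0.
apply/cvg_ex; exists (limn (series da)); apply/cvgrPdist_lt => e e0.
near=> h.
have h0 : h != 0 by near: h; exact: nbhs_dnbhs_neq.
have zhr : `|z + h| <= r.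
  apply: le_trans (ler_normD _ _) _.
  have : `|h| < r - `|z| by near: h; apply: dnbhs0_lt; rewrite subr_gt0.
  by rewrite ltrBrDl => /ltW.
have hM : `|h| < e / M by near: h; apply: dnbhs0_lt; rewrite divr_gt0.
have zh1 : `|z + h| < 1 by apply: le_lt_trans r1.
have key : `|F (z + h) - F z - h * limn (series da)| <= `|h| ^+ 2 * M.
  apply: (@le_norm_lim (series (fun k => a k * (z + h) ^+ k) - series (fun k => a k * z ^+ k)
     - h *: series da)).
    apply: cvgB; first by apply: cvgB; exact: cvg_bounded_pseries.
    by apply: cvgZr.
  move=> n; rewrite /M !mulrA; have := taylor_sum_le n r1 (ltW zr) zhr; rewrite !mulrA.
  apply: le_trans.
  rewrite /series /= !fctE /= !big_mkord scaler_sumr -!sumrB.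
  apply: le_trans (ler_norm_sum _ _ _) _; apply: ler_sum => i _.
  have -> : a i * (z + h) ^+ i - a i * z ^+ i - h *: da i =
    a i * ((z + h) ^+ i - z ^+ i - h * (i%:R * z ^+ i.-1)).
    by rewrite /da /GRing.scale /=; ring.
  by rewrite normrM; apply: ler_piMl.
have -> : limn (series da) - h^-1 *: ((F \o shift z) (h *: (1 : C)) - F z) =
  - (h^-1 * (F (z + h) - F z - h * limn (series da))).
  have -> : h *: (1 : C) = h by rewrite /GRing.scale /= mulr1.
  rewrite /shift /= [h + z]addrC [h^-1 *: _]/(h^-1 * _).
  by rewrite [in RHS]mulrBr mulKf// opprB.
rewrite normrN normrM normfV.
have nh0 : 0 < `|h| by rewrite normr_gt0.
apply: (@le_lt_trans _ _ (`|h| * M)).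
  by rewrite ler_pdivrMl// mulrA -expr2.
by rewrite -ltr_pdivlMr.

Unshelve. all: by end_near. Qed.

End power_series.

Lemma holomorphic_gen_series (R : realType) (B : set nat) :
  holomorphic (sigL (unit_disk R) (@gen_series R B)).
Proof.
move=> z z1.
have a1 n : `|\1_B n : R[i]| <= 1.
  by rewrite indicE normr_nat lern1 leq_b1.
apply: near_eq_derivable (derivable_bounded_pseries a1 z1).
have : nbhs z (ball (0 : R[i]) 1).
  apply: open_nbhs_nbhs; split; first exact: ball_open.
  by rewrite -ball_normE /= sub0r normrN.
apply: filterS => w; rewrite -ball_normE /= sub0r normrN => w1.
have /(congr1 (fun G => G (@gen_series R B) w)) :=
  @sigLK _ _ (0 : R[i]) (unit_disk R).
by rewrite /= => ->; rewrite /patch mem_set.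
Qed.

(* f_B as an element of O(D) *)
Definition gen_fun (R : realType) (B : set nat) : hol_disk R :=
  exist _ (sigL (unit_disk R) (@gen_series R B))
    (mem_set (@holomorphic_gen_series R B)).
Arguments gen_fun R B : clear implicits.

Definition sidon (S : set nat) : Prop :=
  (forall s, S s -> (0 < s)%N) /\
  (forall a b c d, S a -> S b -> S c -> S d -> (a <= b)%N -> (c <= d)%N ->
     (a + b = c + d)%N -> a = c /\ b = d).

Definition sidon_funs (R : realType) : set (hol_disk R) :=
  [set gen_fun R S | S in [set S | sidon S]].
Arguments sidon_funs R : clear implicits.

Definition sidon_funs_upto (R : realType) (n : nat) : set (hol_disk R) :=
  [set gen_fun R S | S in
    [set S | sidon S /\ S `<=` [set k | (1 <= k <= n)%N]]].
Arguments sidon_funs_upto R n : clear implicits.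

Definition is_max (R : realType) (A : set R) (m : R) : Prop :=
  A m /\ ubound A m.

(* Main.v *)
Require Import Defs.
From mathcomp Require Import all_boot all_order all_algebra.
From mathcomp Require Import all_classical all_reals all_analysis.
From mathcomp Require Import complex zify.
Import Order.TTheory GRing.Theory Num.Theory.
Import numFieldNormedType.Exports.
Local Open Scope classical_set_scope.
Local Open Scope ring_scope.

(** Encoding S as its indicator sequence, S |-> f_S is continuous from the
    Cantor space to O(D): if S and T agree below N then |f_S - f_T| is at most
    the geometric tail r^N / (1 - r) on |z| <= r. Being Sidon is a closed
    condition, since a violation involves only four integers, so the set of all
    f_S is compact and phi attains its maximum at some f_S. The truncations of
    this S to {1, ..., n} are Sidon and their generating functions converge to
    f_S, so the maxima over the truncated families are squeezed to the global
    one. *)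

Lemma sidon_closed S :
  (forall N, exists2 T, sidon T & forall n, (n < N)%N -> T n = S n) -> sidon S.
Proof.
move=> h; split=> [s Ss|a b c d Sa Sb Sc Sd].
  by have [T [T0 _] TS] := h s.+1; apply: T0; rewrite TS.
have [T [_ Ts] TS] := h (a + b + c + d).+1.
by apply: Ts; rewrite TS//; lia.
Qed.

Lemma sidon_set0 : sidon set0.
Proof. by split. Qed.

Lemma sidon_sub S T : T `<=` S -> sidon S -> sidon T.
Proof.
move=> TS [S0 Ss]; split=> [s /TS/S0//|a b c d /TS ? /TS ? /TS ? /TS ?].
exact: Ss.
Qed.

Lemma near_forall_ltn (I : Type) (F : set_system I) {FF : Filter F}
    (P : I -> nat -> Prop) (N : nat) :
  (forall n, \forall i \near F, P i n) ->
  \forall i \near F, forall n, (n < N)%N -> P i n.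
Proof.
move=> FP; elim: N => [|N IHN]; first by apply: nearW.
near=> i => n; rewrite ltnS leq_eqVlt => /predU1P[->|].
  by near: i; exact: FP.
by move: n; near: i.
Unshelve. all: by end_near. Qed.

Definition set_of_cantor (x : cantor_space) : set nat := [set n | x n].

(** Coordinate projections are continuous into the discrete space [bool], hence locally constant. *)
Lemma near_set_of_cantor (x : cantor_space) n :
  \forall y \near x, set_of_cantor y n = set_of_cantor x n.
Proof.
have nx : nbhs (proj n x) [set x n] by rewrite nbhs_principalE.
have := @proj_continuous nat (fun=> bool) n x _ nx.
apply: (@filterS _ (nbhs x)) => y /= yx.
by rewrite /set_of_cantor /= -yx.
Qed.

Lemma compact_is_max (R : realType) (T : topologicalType) (f : T -> R) (A : set T) :
  A !=set0 -> compact A -> {within A, continuous f} ->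
  exists m, is_max (f @` A) m.
Proof.
move=> A0 cA cf; have [c cA' cm] := compact_EVT_max A0 cA cf.
exists (f c); split; first by exists c => //; rewrite inE in cA'.
by move=> _ [t At <-]; apply: cm; rewrite inE.
Qed.

(** The sign conditions force [r] and [e * (1 - r)] to be real, so the claim reduces to geometric
    decay in [R]. *)
Lemma near_geom_tail_lt (R : realType) (r e : R[i]) : 0 <= r -> r < 1 -> 0 < e ->
  \forall n \near \oo, r ^+ n / (1 - r) < e.
Proof.
move=> r0 r1 e0.
have rE : r = (complex.Re r)%:C%C by rewrite RRe_real// ger0_real.
have d0 : 0 < e * (1 - r) by rewrite mulr_gt0// subr_gt0.
have dE : e * (1 - r) = (complex.Re (e * (1 - r)))%:C%C.
  by rewrite RRe_real// gtr0_real.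
move: d0; rewrite dE ltcR => d0.
have rr : `|complex.Re r| < 1.
  by move: r0 r1; rewrite rE lecR ltcR => ? ?; rewrite ger0_norm.
move/cvgr0Pnorm_lt : (cvg_expr rr) => /(_ _ d0); apply: filterS => n /= h.
rewrite ltr_pdivrMr ?subr_gt0// dE [X in X ^+ n]rE -rmorphXn /= ltcR.
exact: le_lt_trans (ler_norm _) h.
Qed.

Section generating_functions.
Variable R : realType.
Local Notation C := R[i].

Lemma gen_series_tail_le (S T : set nat) (z r : C) (N : nat) :
  `|z| <= r -> r < 1 -> (forall n, (n < N)%N -> S n = T n) ->
  `|gen_series S z - gen_series T z| <= r ^+ N / (1 - r).
Proof.
move=> zr r1 ST.
have r0 : 0 <= r := le_trans (normr_ge0 z) zr.
have z1 : `|z| < 1 := le_lt_trans zr r1.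
have a1 (B : set nat) n : `|\1_B n : C| <= 1.
  by rewrite indicE normr_nat lern1 leq_b1.
apply: (@le_norm_lim _ (series (fun n => \1_S n * z ^+ n) -
                        series (fun n => \1_T n * z ^+ n))).
  by apply: cvgB; exact: cvg_bounded_pseries.
move=> n; rewrite !fctE /series /= !big_mkord -sumrB.
apply: le_trans (ler_norm_sum _ _ _) _.
(* The factor [(N <= i)%:R] kills the indices where the coefficients cancel; elsewhere two
   indicators differ by at most 1 in modulus. *)
apply: (@le_trans _ _ (\sum_(i < n) (N <= i)%:R * r ^+ i)).
  apply: ler_sum => i _; rewrite -mulrBl normrM normrX.
  case: (leqP N i) => [Ni|iN].
    rewrite mul1r; apply: le_trans (lerXn2r _ _ _ zr); rewrite ?nnegrE//.
    apply: ler_piMl; first exact: exprn_ge0.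
    by rewrite !indicE; do 2 case: (_ \in _);
      rewrite ?subrr ?subr0 ?sub0r ?normrN ?normr0 ?normr1.
  have -> : \1_S (i : nat) = \1_T (i : nat) :> C.
    by rewrite !indicE; congr (nat_of_bool _)%:R; apply/idP/idP; rewrite !inE ST.
  by rewrite subrr normr0 !mul0r.
have -> : \sum_(i < n) (N <= i)%:R * r ^+ i = \sum_(N <= i < n) r ^+ i.
  rewrite -(big_mkord xpredT (fun i => (N <= i)%:R * r ^+ i)).
  case: (leqP N n) => Nn; last first.
    rewrite [RHS]big_geq ?(ltnW Nn)// big_nat big1// => i /= iN.
    by rewrite leqNgt (ltn_trans iN Nn) mul0r.
  rewrite (@big_cat_nat _ _ _ N) //= [X in X + _]big_nat [X in X + _]big1 ?add0r.
    by rewrite !big_nat; apply: eq_bigr => i /andP[-> _]; rewrite mul1r.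
  by move=> i /= iN; rewrite leqNgt iN mul0r.
rewrite -{1}[N]add0n big_addn big_mkord.
under eq_bigr do rewrite exprD mulrC.
by rewrite -mulr_sumr ler_wpM2l ?exprn_ge0// geom_sum_le.
Qed.

(** Compactness, in its near-covering form, turns a choice of [N] valid near each point into one
    valid on all of [K]. *)
Lemma gen_series_uniform_tail (K : set (unit_disk R)) (e : C) : compact K -> 0 < e ->
  exists N, forall S T z, K z -> (forall n, (n < N)%N -> S n = T n) ->
    `|gen_series S (val z) - gen_series T (val z)| < e.
Proof.
move=> /compact_near_coveringP cK e0.
have /(_ _) := cK nat \oo (fun N z =>
   forall S T, (forall n, (n < N)%N -> S n = T n) ->
   `|gen_series S (val z) - gen_series T (val z)| < e) _.
case=> [z Kz|N _ /(_ N (leqnn N)) h]; last by exists N => S T z Kz; exact: h.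
have z1 : `|val z| < 1 by have := valP z; rewrite inE.
(* A radius strictly between the modulus of [z] and 1 gives a neighbourhood of [z] on which a single
   geometric tail serves. *)
have [zr r1] := mid1_lt z1; set r := (1 + `|val z|) / 2 in zr r1.
have r0 : 0 <= r := le_trans (normr_ge0 _) (ltW zr).
exists ([set w : unit_disk R | `|val w| < r], [set n | r ^+ n / (1 - r) < e]) => /=.
  split; last exact: near_geom_tail_lt.
  have : continuous (fun w : unit_disk R => val w) by exact: initial_continuous.
  move=> /(_ z [set w : C | `|w| < r]); apply; apply: open_nbhs_nbhs; split => //=.
  rewrite (_ : [set _ | _] = ball (0 : C) r); first exact: ball_open.
  by apply/seteqP; split => w; rewrite -ball_normE /= sub0r normrN.
move=> [w n] /= [wr nr] S T ST.
by apply: le_lt_trans nr; apply: gen_series_tail_le (ltW wr) r1 _.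
Qed.

(** The filter is arbitrary so as to cover both continuity on the Cantor space and convergence of
    truncations. *)
Lemma gen_fun_cvg (I : Type) (F : set_system I) {FF : Filter F} (B : I -> set nat)
  (S : set nat) : (forall n, \forall i \near F, B i n = S n) ->
  gen_fun R (B i) @[i --> F] --> gen_fun R S.
Proof.
move=> BS.
have BSN N : \forall i \near F, forall n, (n < N)%N -> B i n = S n.
  exact: (near_forall_ltn _ _ (fun i n => B i n = S n)).
have h : set_val (gen_fun R (B i)) @[i --> F] -->
   (set_val (gen_fun R S) : {family compact, unit_disk R -> C}).
  apply/fam_cvgP => K cK P /uniform_nbhs [E [[e e0 eE] EP]].
  have [N hN] := gen_series_uniform_tail _ _ cK e0.
  apply: filterS (BSN N) => i BSi; apply: EP => z Kz; apply: eE.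
  by apply: (hN S (B i) z Kz) => n /BSi.
(* Neighbourhoods in [hol_disk R] are pulled back along [set_val], so [h] suffices. *)
move=> P /= [Q [[V oV <-] VS] QP].
apply: filterS QP _; apply: h; exact: open_nbhs_nbhs.
Qed.

(** The hypothesis says that [P] is closed for the product topology; the family is then a continuous
    image of a closed part of the Cantor space. *)
Lemma compact_gen_fun (P : set (set nat)) :
  (forall S, (forall N, exists2 T, P T & forall n, (n < N)%N -> T n = S n) -> P S) ->
  compact [set gen_fun R S | S in P].
Proof.
move=> Pclosed.
have -> : [set gen_fun R S | S in P] =
    (gen_fun R \o set_of_cantor) @` [set x | P (set_of_cantor x)].
  apply/seteqP; split=> [_ [S PS <-]|_ [x Px <-]]; last by exists (set_of_cantor x).
  have SE : set_of_cantor (fun n => `[< S n >]) = S.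
    by apply/seteqP; split=> n /asboolP.
  by exists (fun n => `[< S n >]); rewrite /= SE.
apply: continuous_compact.
  apply: continuous_subspaceT => x.
  by apply: gen_fun_cvg => n; exact: near_set_of_cantor.
apply: (subclosed_compact _ cantor_space_compact) => //.
rewrite -[X in closed X]setCK; apply: open_closedC; rewrite openE => x /= nPx.
(* A sequence outside [P] has a finite prefix shared by no member of [P]; the cylinder over that
   prefix is an open set avoiding [P]. *)
have [N hN] : exists N, forall T, P T ->
    ~ forall n, (n < N)%N -> T n = set_of_cantor x n.
  apply: contra_notP nPx => /forallNP h; apply: Pclosed => N.
  by have /existsNP[T /not_implyP[PT /contrapT]] := h N; exists T.
have : \forall y \near x, forall n, (n < N)%N ->
    set_of_cantor y n = set_of_cantor x n.
  exact: (near_forall_ltn _ (nbhs x)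
    (fun y n => set_of_cantor y n = set_of_cantor x n) N (near_set_of_cantor x)).
by apply: filterS => y xy /hN; apply.
Qed.

Lemma compact_sidon_funs : compact (sidon_funs R).
Proof. by apply: compact_gen_fun => S; exact: sidon_closed. Qed.

Lemma compact_sidon_funs_upto n : compact (sidon_funs_upto R n).
Proof.
apply: compact_gen_fun => S h; split.
  by apply: sidon_closed => N; have [T [? _]] := h N; exists T.
move=> k Sk; have [T [_ Tn] TS] := h k.+1.
by apply: Tn; rewrite TS.
Qed.

End generating_functions.

Theorem theorem4p1 (R : realType) (phi : hol_disk R -> R)
    (phi_ge0 : forall f, sidon_funs R f -> 0 <= phi f)
    (phi_cont : {within sidon_funs R, continuous phi}) :
  exists (m : R) (mn : nat -> R),
    [/\ is_max (phi @` sidon_funs R) m,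
        forall n, (0 < n)%N -> is_max (phi @` sidon_funs_upto R n) (mn n)
      & mn n @[n --> \oo] --> m].
Proof.
have upto_sub n : sidon_funs_upto R n `<=` sidon_funs R.
  by move=> _ [S [sS _] <-]; exists S.
have [m mP] : exists m, is_max (phi @` sidon_funs R) m.
  apply: compact_is_max (compact_sidon_funs R) phi_cont.
  by exists (gen_fun R set0); exists set0 => //; exact: sidon_set0.
have /choice[mn mnP] n : exists mn, is_max (phi @` sidon_funs_upto R n) mn.
  apply: compact_is_max (compact_sidon_funs_upto R n) _.
    by exists (gen_fun R set0); exists set0 => //; split => //; exact: sidon_set0.
  exact: continuous_subspaceW phi_cont.
exists m, mn; split=> //.
have [[_ [S sS <-] mE] mub] := mP.
pose g n := gen_fun R (S `&` [set k | (1 <= k <= n)%N]).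
have gS n : sidon_funs_upto R n (g n).
  exists (S `&` [set k | (1 <= k <= n)%N]) => //; split; last by move=> k [].
  by apply: sidon_sub sS => k [].
have gcvg : g n @[n --> \oo] --> gen_fun R S.
  (* Truncation at [n] no longer affects [k] once [k <= n]; the lower bound [1 <= k] comes from
     positivity of Sidon elements. *)
  apply: gen_fun_cvg => k; exists k => // n /= kn; apply/propext; split=> [[]//|Sk].
  by split => //=; rewrite kn andbT; exact: sS.1.
have SA : sidon_funs R (gen_fun R S) by exists S.
(* The squeeze is [phi (g n) <= mn n <= m]. *)
apply: (@squeeze_cvgr _ _ _ _ (phi \o g) (fun=> m)); last exact: cvg_cst.
  apply: nearW => n; have [[f fn <-] ub] := mnP n; apply/andP; split.
    by apply: ub; exists (g n).
  by apply: mub; exists f => //; exact: upto_sub fn.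
rewrite -mE => U phiU.
(* Continuity of [phi] is only relative to [sidon_funs R], but the truncations [g n] and their limit
   all lie there. *)
have : within (sidon_funs R) (nbhs (gen_fun R S)) (phi @^-1` U).
  by rewrite (nbhs_subspace_in SA); exact: phi_cont.
move/gcvg => [N _ h]; exists N => // n Nn.
exact: (h n Nn (upto_sub _ _ (gS n))).
Qed.
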